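(* 1) The exponential map $\exp:\hat J_-\to\widehat G_-$ is well defined on the whole of $\hat J_-$. 2) The restriction of the exponential map to the affine subspace $\hat J_\alpha=J_-+\alpha\ln D$ is a bijection between $\hat J_\alpha$ and $\widehat G_\alpha$ if $\frac{\alpha\ln q}{2\pi i}\notin\mathbb Q$.
   Context: Fix $q\in\mathbb C$, $0<|q|<1$, with $\ln q$ chosen by $-\pi<\arg q<\pi$, $\ln1=0$; $q^\alpha=e^{\alpha\ln q}$. $\mathbb C((z^{-1}))$ is the field of formal series $\sum_{i\le N}a_iz^i$; $(\hat h^\alpha f)(z)=f(q^\alpha z)$. $J_-$ is the space of formal series $\sum_{i\ge1}a_iD^{-i}$, $a_i\in\mathbb C((z^{-1}))$. $\widehat G_\alpha$ ($\alpha\in\mathbb C$) is the set of formal series $L=D^\alpha+\sum_{i\ge1}a_iD^{\alpha-i}$, $a_i\in\mathbb C((z^{-1}))$; $\widehat G_-=\bigcup_{\alpha\in\mathbb C}\widehat G_\alpha$ is a group with multiplication determined by $D^\alpha\circ a=(\hat h^\alpha a)\circ D^\alpha$. $\sigma_\beta(X)=D^\beta XD^{-\beta}$. $\hat J_-=J_-\oplus\mathbb C\ln D$, with $[\ln D,f]=\ln q\cdot z\,df/dz$ for $f\in\mathbb C((z^{-1}))$ and $[\ln D,D]=0$, is the tangent Lie algebra of $\widehat G_-$. The exponential map: for $Y=X+\beta\ln D\in\hat J_-$ ($X\in J_-$, $\beta\in\mathbb C$), $\exp(tY)$ is the solution $L(t)$ of $\frac{dL}{dt}=L\,Y$ (left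 translate of $Y$) with $L(0)=1$; explicitly $\exp(tY)=A(t)D^{\beta t}$ where $A(t)\in\widehat G_0$, $t\in\mathbb C$, is the solution of $\frac{dA}{dt}=A\,\sigma_{\beta t}(X)$, $A(0)=1$ (differentiation in $t$ applied to each coefficient of $z^jD^{-i}$). Part 1) means that this equation has a unique solution. *)

(* Defs.v *)
From HB Require Import structures.
From mathcomp Require Import all_boot all_order all_algebra.
From mathcomp Require Import all_classical all_reals all_analysis.
From mathcomp Require Import complex.

Set Implicit Arguments.
Unset Strict Implicit.
Unset Printing Implicit Defensive.

Import Order.TTheory GRing.Theory Num.Theory.
Import numFieldNormedType.Exports.

Local Open Scope classical_set_scope.
Local Open Scope ring_scope.
Local Open Scope complex_scope.

Section ComplexElementary.
Variable R : realType.
Implicit Types w q alpha : R[i].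

Definition cexp w : R[i] :=
  let: x +i* y := w in (expR x * cos y) +i* (expR x * sin y).

(* `|w| is an element of R[i] whose real part is the modulus of w; carg takes
   its values in ]-pi, pi], the value pi being reached exactly on the negative
   real axis. *)
Definition carg w : R :=
  let theta := acos (complex.Re w / complex.Re `|w|) in
  if 0 <= complex.Im w then theta else - theta.

Definition cln w : R[i] := ln (complex.Re `|w|) +i* carg w.

Definition qpow q alpha : R[i] := cexp (alpha * cln q).

End ComplexElementary.

(* C((z^-1)): the series \sum_m f_m z^m with f_m = 0 for m large. *)
Section LaurentSeries.
Variable R : realType.

Definition finite_top : {pred int -> R[i]} :=
  fun f => `[< exists N : int, forall m : int, N < m -> f m = 0 >].

Lemma finite_top_zmod_closed : zmod_closed finite_top.
Proof.
split; first by apply/asboolP; exists 0.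
move=> f g /asboolP[M fM] /asboolP[N gN]; apply/asboolP.
exists (Num.max M N) => m; rewrite gt_max => /andP[Mm Nm].
by rewrite !fctE fM // gN // subr0.
Qed.

HB.instance Definition _ :=
  GRing.isZmodClosed.Build (int -> R[i]) finite_top finite_top_zmod_closed.

Record laurent := Laurent {
  lcoef :> int -> R[i];
  lcoefP : lcoef \in finite_top }.

HB.instance Definition _ := [isSub for lcoef].
HB.instance Definition _ := [Choice of laurent by <:].
HB.instance Definition _ := [SubChoice_isSubZmodule of laurent by <:].

Implicit Types f g : laurent.

Lemma lone_subproof : (fun m : int => (m == 0)%:R : R[i]) \in finite_top.
Proof. by apply/asboolP; exists 0 => m; case: eqVneq => // ->; rewrite ltxx. Qed.

Definition lone : laurent := Laurent lone_subproof.

(* The sum over j : int has finitely many nonzero terms. *)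
Lemma lmul_subproof f g :
  (fun m : int => \sum_(j \in [set: int]) f j * g (m - j)) \in finite_top.
Proof.
have /asboolP[M fM] := lcoefP f; have /asboolP[N gN] := lcoefP g.
apply/asboolP; exists (M + N) => m MNm; apply: fsbig1 => j _.
have [/fM->|jM] := ltP M j; first by rewrite mul0r.
by rewrite gN ?mulr0// ltrBrDr (le_lt_trans _ MNm)// addrC lerD2r.
Qed.

Definition lmul f g : laurent := Laurent (lmul_subproof f g).

Lemma ldilate_subproof (c : R[i]) f :
  (fun m : int => c ^ m * f m) \in finite_top.
Proof.
have /asboolP[M fM] := lcoefP f.
by apply/asboolP; exists M => m /fM ->; rewrite mulr0.
Qed.

(* f(z) |-> f(c z) *)
Definition ldilate (c : R[i]) f : laurent := Laurent (ldilate_subproof c f).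

Definition hhat (q alpha : R[i]) f : laurent := ldilate (qpow q alpha) f.

End LaurentSeries.

(* QSym alpha a stands for \sum_(i >= 0) a_i D^(alpha - i).  This encoding is
   not injective in general (a_0 may vanish), but it is on each of the sets
   Jminus, Ghat and Ghatminus below, where the value of a_0 is fixed. *)
Section Symbols.
Variable R : realType.

Record qsym := QSym {
  qord : R[i];
  qcoef : nat -> laurent R }.

HB.instance Definition _ := gen_eqMixin qsym.
HB.instance Definition _ := gen_choiceMixin qsym.

Implicit Types (q alpha beta t : R[i]) (L M X : qsym).

(* a_i D^(alpha-i) o b_j D^(beta-j)
     = a_i (hhat^(alpha-i) b_j) D^(alpha+beta-i-j) *)
Definition qmul q L M : qsym :=
  QSym (qord L + qord M)
    (fun n => \sum_(i < n.+1)
       lmul (qcoef L i) (hhat q (qord L - (i : nat)%:R) (qcoef M (n - i)%N))).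

Definition Dpow alpha : qsym :=
  QSym alpha (fun i => if i == 0%N then lone R else 0).

Definition Jminus : set qsym := [set X | qord X = 0 /\ qcoef X 0%N = 0].

Definition Ghat alpha : set qsym :=
  [set L | qord L = alpha /\ qcoef L 0%N = lone R].

Definition Ghatminus : set qsym := \bigcup_(alpha in [set: R[i]]) Ghat alpha.

Definition qsigma q beta X : qsym := qmul q (qmul q (Dpow beta) X) (Dpow (- beta)).

(* The pair (X, beta) stands for X + beta ln D. *)
Definition Jhat : set (qsym * R[i]) := [set Y | Jminus Y.1].

Definition Jhat_aff alpha : set (qsym * R[i]) :=
  [set Y | Jminus Y.1 /\ Y.2 = alpha].

(* A' = A sigma_(beta t)(X), A(0) = 1, with A(t) in Ghat 0 for all complex t;
   A' is the complex derivative of each coefficient of z^m D^(-i). *)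
Definition exp_solution q (Y : qsym * R[i]) (A : R[i] -> qsym) : Prop :=
  [/\ forall t, Ghat 0 (A t),
      A 0 = Dpow 0 &
      forall t (i : nat) (m : int),
        is_derive (t : R[i]^o) (1 : R[i]^o)
          (fun s : R[i]^o => qcoef (A s) i m : R[i]^o)
          (qcoef (qmul q (A t) (qsigma q (Y.2 * t) Y.1)) i m)].

(* exp (t Y) = A(t) D^(beta t), where A solves the equation above. *)
Definition qexp_path q (Y : qsym * R[i]) t : qsym :=
  qmul q (xget (fun=> Dpow 0) [set A | exp_solution q Y A] t) (Dpow (Y.2 * t)).

Definition qexp q (Y : qsym * R[i]) : qsym := qexp_path q Y 1.

End Symbols.

(* Main.v *)
Require Import Defs.
From mathcomp Require Import all_boot all_order all_algebra.
From mathcomp Require Import all_classical all_reals all_analysis.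
From mathcomp Require Import complex.
From mathcomp Require Import ring lra zify.
Import Order.TTheory GRing.Theory Num.Theory.
Import numFieldNormedType.Exports.
Local Open Scope classical_set_scope.
Local Open Scope ring_scope.
Local Open Scope complex_scope.

(** Write [Y = X + b ln D], [X = \sum_(i >= 1) x_i D^(-i)], and
    [A(t) = 1 + \sum_(n >= 1) a_n(t) D^(-n)].  Since [x_0 = 0], the coefficient
    of [D^(-n)] in [A sigma_(b t)(X)] only involves [a_0, ..., a_(n-1)]
    ([qcoef_mul_sigma]), so that the equation [A' = A sigma_(b t)(X)] is a
    triangular system: the derivative of [a_n] is a function already known, and
    [a_n(0)] is prescribed.

    Uniqueness is then the fact that a function on the complex plane with zero
    derivative is constant ([derive_inj], [coef_solution_local]).  For
    existence, each coefficient of [z^m] in the right-hand side is a finite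
    linear combination of functions [t^k e^(c t)], a class which is closed under
    the operations of the system, primitives included ([exppoly_primitive]);
    moreover the degrees in [z] stay bounded above uniformly in [t], so that
    every [a_n(t)] is a Laurent series ([regular], [coef_solution_exists]).

    For the bijection, fix [n] and vary [x_n] alone.  The unknowns below [n] do
    not change, and the derivative of [a_n] depends on [x_n] only through the
    term [a_0 x_n(q^(b t) z) = x_n(q^(b t) z)], whose coefficient of [z^m] is
    [e^(w t) x_(n,m)] with [w = b m ln q].  Hence [a_(n,m)(1)] is the product of
    [x_(n,m)] by the integral of [e^(w t)] over [0, 1], plus a term independent
    of [x_n] ([coef_solution_variation]).  That integral is [1] for [w = 0] and
    [(e^w - 1) / w] otherwise; it vanishes only if [w] is a nonzero multiple of
    [2 pi i], which forces [b ln q / (2 pi i)] to be rational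
    ([nonresonant_irrational]).  In all other cases any prescribed values
    [a_n(1)], which are the coefficients of [exp Y] ([qexpE]), determine [x_1],
    [x_2], ... one after the other ([coef_solution_inj],
    [coef_solution_surj]). *)

Set Implicit Arguments.
Unset Strict Implicit.
Unset Printing Implicit Defensive.

(** * Derivatives on the complex plane *)

(** Over a number field of either kind, so that it transports estimates between
    the real line and the complex plane. *)
Lemma is_derive_littleo (K : numFieldType) (f : K^o -> K^o) (t d : K^o) :
  is_derive t (1 : K^o) f d <->
  forall e : K, 0 < e -> exists2 r : K, 0 < r &
    forall h : K, `|h| < r -> `|f (t + h) - f t - h * d| <= e * `|h|.
Proof.
set g := fun h : K => h^-1 *: ((f \o shift t) (h *: (1 : K^o)) - f t).
have gE h : h != 0 -> d - g h = - (h^-1 * (f (t + h) - f t - h * d)).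
  move=> h0; rewrite /g /= [h *: _]mulr1 [h + t]addrC.
  by rewrite [_ *: _]/(_ * _) mulrBr mulKf// opprB.
have -> : is_derive t (1 : K^o) f d <-> g h @[h --> 0^'] --> d.
  split=> [[fd <-]|gd]; first exact: fd.
  by apply: DeriveDef; [exact: (cvgP _ gd)|exact: cvg_lim gd].
split=> [/cvgrPdist_le gd e e0|H].
  have := gd _ e0.
  move=> /nbhs_ballP[r /= r0 rP]; exists r => // h hr.
  have [->|h0] := eqVneq h 0.
    by rewrite addr0 subrr mul0r subr0 normr0 mulr0.
  have := rP h; rewrite /= /ball /= sub0r normrN => /(_ hr h0).
  rewrite gE// normrN normrM normfV ler_pdivrMl ?normr_gt0//.
  by rewrite [`|h| * e]mulrC.
apply/cvgrPdist_le => e e0; have [r r0 rP] := H e e0.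
apply/nbhs_ballP; exists r => //= h; rewrite /ball /= sub0r normrN => hr h0.
rewrite gE// normrN normrM normfV ler_pdivrMl ?normr_gt0// [`|h| * e]mulrC.
exact: rP.
Qed.

Section ComplexCalculus.
Variable R : realType.
Local Notation C := R[i].

Lemma gtc0P (e : C) : 0 < e -> exists2 r : R, 0 < r & e = r%:C.
Proof. by case: e => a b; rewrite ltcE /= => /andP[/eqP-> a0]; exists a. Qed.

Lemma normc_real (x : R) : `|x%:C : C| = `|x|%:C.
Proof. by rewrite normc_def /= expr0n addr0 sqrtr_sqr. Qed.

Lemma normc_i : `|'i : C| = 1.
Proof. by rewrite normc_def /= expr0n expr1n add0r sqrtr1. Qed.

Lemma normc_le_ReIm (z : C) : `|z| <= (`|complex.Re z| + `|complex.Im z|)%:C.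
Proof.
rewrite [z in `|z|]complexE (le_trans (ler_normD _ _))// rmorphD lerD//=.
  by rewrite normc_real.
by rewrite normrM normc_i mul1r normc_real.
Qed.

Lemma normc_ge_Im (z : C) : `|complex.Im z|%:C <= `|z|.
Proof.
have := normc_ge_Re (z * 'i); rewrite ReiNIm normrN => /le_trans; apply.
by rewrite normrM normc_i mulr1.
Qed.

(** Along the segment from [0] to [t], the real part of [f] is a real function
    with zero derivative, to which the mean value theorem applies. *)
Lemma Re_derive0_cst (f : C^o -> C^o) :
  (forall t : C^o, is_derive t (1 : C^o) f 0) ->
  forall t, complex.Re (f t) = complex.Re (f 0).
Proof.
move=> f0 z; pose g (s : R) : R := complex.Re (f (s%:C * z)).
have -> : complex.Re (f z) = g 1 by rewrite /g mul1r.
have -> : complex.Re (f 0) = g 0 by rewrite /g mul0r.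
apply: is_derive_0_is_cst => s; apply/is_derive_littleo => e e0.
have [z0|z0] := eqVneq z 0.
  exists 1 => // h _; rewrite /g z0 !mulr0 subrr subr0 normr0.
  by rewrite mulr_ge0 ?(ltW e0).
have nz0 : 0 < `|z| by rewrite normr_gt0.
have /is_derive_littleo/(_ (e%:C / `|z|)) := f0 (s%:C * z).
case; first by rewrite divr_gt0// ltcR.
move=> r0 r00 rP; have : 0 < r0 / `|z| by rewrite divr_gt0.
move=> /gtc0P[r rp rE]; exists r => // h hr.
have := rP (h%:C * z); rewrite [_ * 0]mulr0 subr0 -mulrDl normrM mulrA.
rewrite -ltr_pdivlMr// rE normc_real ltcR => /(_ hr).
rewrite mulrAC divfK ?gt_eqF// => le.
rewrite mulr0 subr0 -lecR rmorphM/=; apply: le_trans le.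
rewrite /g rmorphD/= mulrDl.
by apply: le_trans (normc_ge_Re _); rewrite raddfB.
Qed.

Lemma derive0_cst (f : C^o -> C^o) :
  (forall t : C^o, is_derive t (1 : C^o) f 0) -> forall t, f t = f 0.
Proof.
move=> f0 t; have re := Re_derive0_cst f0 t.
(* the imaginary part of f is minus the real part of 'i * f *)
have fi0 (s : C^o) : is_derive s (1 : C^o) (fun s => 'i * f s : C^o) 0.
  by have := is_deriveZ ('i : C) (f0 s); rewrite scaler0.
have := Re_derive0_cst fi0 t; move: re.
case: (f t) (f 0) => [a b] [c d] /= ->.
by rewrite !mul0r !sub0r !mul1r => /oppr_inj->.
Qed.

Lemma derive_inj (f g df : C^o -> C^o) : f 0 = g 0 ->
  (forall t : C^o, is_derive t (1 : C^o) f (df t)) ->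
  (forall t : C^o, is_derive t (1 : C^o) g (df t)) -> f = g.
Proof.
move=> fg0 fd gd; apply/funext => t; apply/eqP; rewrite -subr_eq0; apply/eqP.
have fgd (s : C^o) : is_derive s (1 : C^o) (f - g) 0.
  by rewrite -(subrr (df s)); exact: is_deriveB.
by have := derive0_cst fgd t; rewrite !fctE fg0 subrr.
Qed.

(** * The complex exponential *)

Lemma cexp0 : cexp (0 : C) = 1.
Proof. by rewrite /cexp /= expR0 cos0 sin0 !mulr1 mulr0. Qed.

Lemma cexpD (v w : C) : cexp (v + w) = cexp v * cexp w.
Proof.
case: v w => [a b] [c d]; rewrite /cexp /= expRD cosD sinD.
by apply/eqP; rewrite eq_complex /=; apply/andP; split; apply/eqP; ring.
Qed.

Lemma cexp_neq0 (w : C) : cexp w != 0.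
Proof.
apply/eqP => w0; have /eqP := cexp0; rewrite -(subrr w) cexpD w0 mul0r.
by rewrite eq_sym oner_eq0.
Qed.

Lemma cexpMz (w : C) (m : int) : cexp w ^ m = cexp (w * m%:~R).
Proof.
have cexpMn n : cexp w ^+ n = cexp (w * n%:R).
  elim: n => [|n IH]; first by rewrite mulr0 cexp0.
  by rewrite exprS IH -cexpD -natr1 mulrDr mulr1 addrC.
case: m => n; first exact: cexpMn.
rewrite -[_ ^ _]/(cexp w ^- n.+1) cexpMn NegzE mulrNz mulrN.
apply: (mulfI (cexp_neq0 (w * n.+1%:R))).
by rewrite mulfV ?cexp_neq0// -cexpD subrr cexp0.
Qed.

(** Differentiability at [0], from that of [expR], [cos] and [sin]: with
    [h = x + i y], the real part of [e^h - 1 - h] is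
    [(e^x - 1 - x) cos y + (1 + x) (cos y - 1)] and its imaginary part is
    [e^x (sin y - y) + (e^x - 1) y]. *)
Lemma cexp_littleo (e : C) : 0 < e -> exists2 r : C, 0 < r &
  forall h : C, `|h| < r -> `|cexp h - 1 - h| <= e * `|h|.
Proof.
(* the four products above are at most d, 2 d, 3 d and 2 d times the modulus
   of h, whence the factor 8 *)
move=> /gtc0P[e' e'0 ->]; pose d := Num.min (e' / 8) 1.
have d0 : 0 < d by rewrite lt_min ltr01 divr_gt0.
have d1 : d <= 1 by rewrite ge_min lexx orbT.
have de : d * 8 <= e' by rewrite -ler_pdivlMr// ge_min lexx.
move: d d0 d1 de => d d0 d1 de.
have /is_derive_littleo/(_ d d0)[r1 r10 E] := is_derive_expR (0 : R).
have /is_derive_littleo/(_ d d0)[r2 r20 Co] := is_derive_cos (0 : R).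
have /is_derive_littleo/(_ d d0)[r3 r30 S] := is_derive_sin (0 : R).
pose r := Num.min (Num.min r1 r2) (Num.min r3 d).
exists r%:C; first by rewrite ltcR !lt_min r10 r20 r30 d0.
move=> h; have := normr_ge0 h; move: (normc_ge_Re h) (normc_ge_Im h).
have -> : `|h| = (complex.Re `|h|)%:C by rewrite normc_def.
move: (complex.Re `|h|) => n; case: h => x y.
rewrite !lecR ltcR !lt_min /= => xn yn n0 /andP[/andP[n1 n2] /andP[n3 nd]].
have := E x (le_lt_trans xn n1); have := Co y (le_lt_trans yn n2).
have := S y (le_lt_trans yn n3).
rewrite !add0r expR0 cos0 sin0 !subr0 oppr0 mulr0 !subr0 !mulr1 => Sy Cy Ex.
apply: le_trans (normc_le_ReIm _) _; rewrite -rmorphM lecR /=.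
have dn : d * n <= d by rewrite ger_pMr// (le_trans (ltW nd)).
have Ex1 : `|expR x - 1| <= 2 * d.
  have -> : expR x - 1 = (expR x - 1 - x) + x by ring.
  rewrite (le_trans (ler_normD _ _))// mulr2n mulrDl mul1r lerD//.
    by rewrite (le_trans Ex)// (le_trans _ dn)// ler_pM2l.
  by rewrite (le_trans xn)// ltW.
have x1 : `|1 + x| <= 2.
  rewrite (le_trans (ler_normD _ _))// normr1 mulr2n lerD//.
  by rewrite (le_trans xn)// (le_trans (ltW nd)).
have e3 : `|expR x| <= 3.
  have -> : expR x = (expR x - 1) + 1 by ring.
  rewrite (le_trans (ler_normD _ _))// normr1; lra.
have dx : d * `|x| <= d * n by rewrite ler_pM2l.
have dy : d * `|y| <= d * n by rewrite ler_pM2l.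
have -> : expR x * cos y - 1 - x =
  (expR x - 1 - x) * cos y + (1 + x) * (cos y - 1) by ring.
have -> : expR x * sin y - 0 - y =
  expR x * (sin y - y) + (expR x - 1) * y by ring.
have A1 : `|(expR x - 1 - x) * cos y| <= d * n * 1.
  by rewrite normrM ler_pM// ?cos_max// (le_trans Ex).
have A2 : `|(1 + x) * (cos y - 1)| <= 2 * (d * n).
  by rewrite normrM ler_pM// (le_trans Cy).
have A3 : `|expR x * (sin y - y)| <= 3 * (d * n).
  by rewrite normrM ler_pM// (le_trans Sy).
have A4 : `|(expR x - 1) * y| <= 2 * d * n by rewrite normrM ler_pM.
have := ler_normD ((expR x - 1 - x) * cos y) ((1 + x) * (cos y - 1)).
have := ler_normD (expR x * (sin y - y)) ((expR x - 1) * y).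
have : d * n * 8 <= e' * n by rewrite mulrAC ler_wpM2r.
lra.
Qed.

Lemma is_derive_cexpM (w : C) (t : C^o) :
  is_derive t (1 : C^o) (fun s : C^o => cexp (w * s) : C^o) (w * cexp (w * t)).
Proof.
apply/is_derive_littleo => e e0; set u := cexp (w * t).
(* the + 1 keep the denominators nonzero when w = 0 *)
have k0 : 0 < `|u| * `|w| + 1 by rewrite ltr_wpDl ?mulr_ge0.
have [r r0 rP] := cexp_littleo (divr_gt0 e0 k0).
have w0 : 0 < `|w| + 1 by rewrite ltr_wpDl.
exists (r / (`|w| + 1)); first by rewrite divr_gt0.
move=> h; rewrite ltr_pdivlMr// => hr.
have -> : cexp (w * (t + h)) - u - h * (w * u) = u * (cexp (w * h) - 1 - w * h).
  by rewrite mulrDr cexpD -/u; ring.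
rewrite normrM.
have hw : `|w * h| < r.
  by rewrite (le_lt_trans _ hr)// normrM mulrC ler_wpM2l// lerDl.
rewrite (le_trans (ler_wpM2l (normr_ge0 _) (rP _ hw)))// normrM.
have -> : `|u| * (e / (`|u| * `|w| + 1) * (`|w| * `|h|)) =
  (`|u| * `|w| / (`|u| * `|w| + 1)) * (e * `|h|) by ring.
rewrite ler_piMl ?mulr_ge0 ?(ltW e0)//.
by rewrite ler_pdivrMr// mul1r lerDl.
Qed.

(** The modulus gives [x = 0] in [w = x + i y]; then [cos y = 1], and [y] is
    brought into [[0, 2 pi[], where [cos] is injective on each half of the
    interval. *)
Lemma cexp_eq1 (w : C) :
  cexp w = 1 -> exists k : int, w = (2 * pi * k%:~R)%:C * 'i.
Proof.
case: w => x y [rx ix].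
have x0 : x = 0.
  apply: expR_inj; rewrite expR0; apply/eqP.
  have : expR x ^+ 2 = 1 ^+ 2.
    rewrite -[LHS]mulr1 -[in LHS](cos2Dsin2 y) mulrDr -!exprMn rx ix.
    by rewrite expr1n expr0n /= addr0.
  by move/eqP; rewrite eqrXn2 ?expR_ge0.
move: rx; rewrite {ix}x0 expR0 mul1r => cy.
have pi2 : 0 < 2 * pi :> R by rewrite mulr_gt0 ?pi_gt0.
have [k] : exists k : int, 0 <= y - 2 * pi * k%:~R < 2 * pi.
  exists (Num.floor (y / (2 * pi))).
  have /andP[] := floor_itv (y / (2 * pi)).
  move: (Num.floor _) => k; rewrite ler_pdivlMr// ltr_pdivrMr// intrD => l u.
  by apply/andP; split; lra.
set z := y - _ => /andP[z0 z2].
have cosD2piMn (a : R) n : cos (a + 2 * pi * n%:R) = cos a.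
  rewrite mulr_natr [2 * pi]mulr_natl.
  by apply: periodicn; exact: cosD2pi.
have cz : cos z = 1.
  rewrite -cy /z; case: (k) => n.
    by rewrite -pmulrn -(cosD2piMn (y - _) n) subrK.
  by rewrite NegzE mulrNz mulrN opprK -pmulrn cosD2piMn.
have z00 : z = 0.
  have [zpi|piz] := leP z pi.
    by apply: cos_inj; rewrite ?in_itv /= ?z0 ?zpi ?lexx ?pi_ge0// cos0.
  have : 2 * pi - z = 0.
    apply: cos_inj; rewrite ?in_itv /= ?lexx ?pi_ge0//; first lra.
    by rewrite cos0 mulr_natl cosB cos2pi sin2pi cz mulr1 mul0r addr0.
  lra.
exists k; apply/eqP; rewrite eq_complex /=.
by rewrite !mul0r !mulr0 subr0 mulr1 addr0 eqxx /= -subr_eq0 -/z z00.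
Qed.

(** * Primitives of exponential polynomials *)

Definition is_primitive (f F : C^o -> C^o) :=
  F 0 = 0 /\ forall t : C^o, is_derive t (1 : C^o) F (f t).

Definition primitive (f : C^o -> C^o) : C^o -> C^o :=
  xget (fun=> 0) [set F | is_primitive f F].

Lemma primitiveE f F : is_primitive f F -> primitive f = F.
Proof.
move=> fF; rewrite /primitive; case: xgetP => [G _ fG|/(_ F)//].
by apply: derive_inj fG.2 fF.2; rewrite fG.1 fF.1.
Qed.

Lemma is_primitiveD f g F G : is_primitive f F -> is_primitive g G ->
  is_primitive (fun t => f t + g t) (fun t => F t + G t).
Proof.
move=> [F0 Fd] [G0 Gd]; split; first by rewrite F0 G0 addr0.
by move=> t; exact: is_deriveD.
Qed.

Lemma is_primitiveZ (a : C) f F : is_primitive f F ->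
  is_primitive (fun t => a * f t) (fun t => a * F t).
Proof.
move=> [F0 Fd]; split; first by rewrite F0 mulr0.
by move=> t; exact: is_deriveZ.
Qed.

Lemma is_primitive_derive (F f : C^o -> C^o) :
  (forall t : C^o, is_derive t (1 : C^o) F (f t)) ->
  is_primitive f (fun t => F t - F 0).
Proof.
move=> Fd; split; first by rewrite subrr.
by move=> t; rewrite -[f t]subr0; apply: is_deriveB.
Qed.

Lemma primitive0 : primitive (fun=> 0) = fun=> 0.
Proof. by apply: primitiveE; split=> // t; exact: is_derive_cst. Qed.

(** The class in which the coefficients of the solution live: it contains what
    dilation by [q^(b t)] produces and is closed under taking primitives. *)
Inductive exppoly : (C^o -> C^o) -> Prop :=
| exppoly_monomial a k c : exppoly (fun t => a * t ^+ k * cexp (c * t))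
| exppolyD f g : exppoly f -> exppoly g -> exppoly (fun t => f t + g t).

Lemma exppoly_cst (a : C) : exppoly (fun=> a).
Proof.
have := exppoly_monomial a 0 0; congr exppoly; apply/funext => t.
by rewrite expr0 mulr1 mul0r cexp0 mulr1.
Qed.

Lemma exppolyM_cexp (a c : C) f :
  exppoly f -> exppoly (fun t => f t * (a * cexp (c * t))).
Proof.
elim=> {f} [b k d|f g _ fP _ gP].
  have := exppoly_monomial (a * b) k (d + c); congr exppoly; apply/funext => t.
  by rewrite mulrDl cexpD; ring.
by have := exppolyD fP gP; congr exppoly; apply/funext => t; rewrite mulrDl.
Qed.

Lemma exppolyZ (a : C) f : exppoly f -> exppoly (fun t => a * f t).
Proof.
move=> /(exppolyM_cexp a 0); congr exppoly; apply/funext => t.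
by rewrite mul0r cexp0 mulr1 mulrC.
Qed.

Lemma exppoly_sum (I : Type) (r : seq I) (f : I -> C^o -> C^o) :
  (forall i, exppoly (f i)) -> exppoly (fun t => \sum_(i <- r) f i t).
Proof.
move=> fP; elim: r => [|i r IH].
  by have := exppoly_cst 0; congr exppoly; apply/funext => t; rewrite big_nil.
have := exppolyD (fP i) IH; congr exppoly; apply/funext => t.
by rewrite big_cons.
Qed.

Lemma is_derive_monomial (k : nat) (c : C) (t : C^o) :
  is_derive t (1 : C^o) (fun t : C^o => t ^+ k * cexp (c * t) : C^o)
    (k%:R * t ^+ k.-1 * cexp (c * t) + c * (t ^+ k * cexp (c * t))).
Proof.
have := is_deriveX k (is_derive_id t (1 : C^o)).
rewrite exprfctE => /(is_deriveM)/(_ (is_derive_cexpM c t)) D.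
have E := is_derive_eq D.
apply: E; rewrite /GRing.scale /=.
by ring.
Qed.

(** Integration by parts lowers [k]: for [c != 0], a primitive of
    [t^(k+1) e^(c t)] is [t^(k+1) e^(c t) / c] minus [(k + 1) / c] times one of
    [t^k e^(c t)]. *)
Lemma exppoly_monomial_primitive (k : nat) (c : C) :
  exists2 F, exppoly F & is_primitive (fun t => t ^+ k * cexp (c * t)) F.
Proof.
have [->|c0] := eqVneq c 0.
  exists (fun t => k.+1%:R^-1 * t ^+ k.+1 * cexp (0 * t)).
    exact: exppoly_monomial.
  have := is_primitiveZ k.+1%:R^-1
    (is_primitive_derive (is_derive_monomial k.+1 0)).
  congr is_primitive; apply/funext => t.
    by rewrite [X in _ + X]mul0r addr0 !mulrA mulVf ?mul1r// pnatr_eq0.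
  by rewrite expr0n [X in _ - X]mul0r subr0 mulrA.
elim: k => [|k [F FP [F0 Fd]]].
  exists (fun t => c^-1 * 1 * cexp (c * t) + - c^-1).
    by apply: exppolyD (exppoly_cst _); exact: (exppoly_monomial c^-1 0 c).
  have := is_primitiveZ c^-1 (is_primitive_derive (is_derive_monomial 0 c)).
  congr is_primitive; apply/funext => t.
    by rewrite !mul0r add0r mulKf.
  by rewrite !expr0 !mul1r mulr0 cexp0 mulrBr !mulr1.
exists (fun t => c^-1 * t ^+ k.+1 * cexp (c * t) + (- (k.+1%:R / c)) * F t).
  by apply: exppolyD; [exact: exppoly_monomial|exact: exppolyZ].
have P1 := is_primitiveZ c^-1 (is_primitive_derive (is_derive_monomial k.+1 c)).
have P2 := is_primitiveZ (- (k.+1%:R / c)) (conj F0 Fd).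
have := is_primitiveD P1 P2; congr is_primitive; apply/funext => t.
  by rewrite /=; field.
by rewrite expr0n [X in _ - X]mul0r subr0 mulrA.
Qed.

Lemma exppoly_primitive f : exppoly f ->
  exppoly (primitive f) /\ is_primitive f (primitive f).
Proof.
suff : exppoly f -> exists2 F, exppoly F & is_primitive f F.
  by move=> + fP => /(_ fP)[F FP fF]; rewrite (primitiveE fF).
elim=> {f} [a k c|f g _ [F FP fF] _ [G GP gG]].
  have [F FP fF] := exppoly_monomial_primitive k c.
  exists (fun t => a * F t); first exact: exppolyZ.
  have := is_primitiveZ a fF; congr is_primitive.
  by apply/funext => t; rewrite mulrA.
by exists (fun t => F t + G t); [exact: exppolyD|exact: is_primitiveD].
Qed.

(** The value at [1] is the integral of [e^(w t)] over [[0, 1]], that is [1] if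
    [w = 0] and [(e^w - 1) / w] otherwise. *)
Lemma primitive_cexp_neq0 (w : C) :
  (forall k : int, w = (2 * pi * k%:~R)%:C * 'i -> w = 0) ->
  primitive (fun t => cexp (w * t)) 1 != 0.
Proof.
have [->|w0] := eqVneq w 0 => wP.
  rewrite (@primitiveE _ id) ?oner_neq0//; split=> // t.
  by rewrite mul0r cexp0; exact: is_derive_id.
rewrite (@primitiveE _ (fun t => w^-1 * (cexp (w * t) - 1))).
  rewrite mulr1 mulf_neq0 ?invr_neq0// subr_eq0; apply/eqP => /cexp_eq1[k /wP].
  exact/eqP.
have := is_primitiveZ w^-1 (is_primitive_derive (is_derive_cexpM w)).
by congr is_primitive; apply/funext => t; rewrite ?mulKf// mulr0 cexp0.
Qed.

End ComplexCalculus.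

(** * Laurent series in 1/z *)

Section LaurentAlgebra.
Variable R : realType.
Implicit Types (f g : laurent R) (m M N : int).

Definition vanishes_above N f := forall m, N < m -> f m = 0.

Lemma laurent_top f : exists N, vanishes_above N f.
Proof. by have /asboolP := lcoefP f. Qed.

Lemma laurent_ext f g : (forall m, f m = g m) -> f = g.
Proof. by move=> fg; apply/val_inj/funext. Qed.

Lemma lcoefD f g m : (f + g) m = f m + g m.
Proof. by []. Qed.

(** The same finite list of indices serves all factors with given bounds on
    their degrees; this turns a product of series depending on a parameter into
    a finite sum of functions of the parameter. *)
Lemma lmul_big M N m : exists r : seq int, forall f g,
  vanishes_above M f -> vanishes_above N g ->
  lmul f g m = \sum_(j <- r) f j * g (m - j).
Proof.
(* the terms vanish unless m - N <= j <= M *)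
pose r := [seq M - k%:Z | k <- iota 0 (absz (M + N - m)%R).+1].
have r_uniq : uniq r.
  by rewrite map_inj_uniq ?iota_uniq// => i j /addrI/oppr_inj[].
exists r => f g fM gN /=.
rewrite (@fsbigE _ _ _ _ _ r)//.
  by apply: eq_bigl => j; rewrite in_setT.
move=> j _ jr; have [Mj|jM] := ltP M j; first by rewrite fM ?mul0r.
have [jN|Nj] := ltP N (m - j); first by rewrite gN ?mulr0.
case/negP: jr; apply/mapP; exists (absz (M - j)%R); last first.
  by rewrite gez0_abs ?subr_ge0// opprB addrC subrK.
by rewrite mem_iota add0n leq0n ltnS; lia.
Qed.

Lemma vanishes_above_lmul M N f g :
  vanishes_above M f -> vanishes_above N g ->
  vanishes_above (M + N) (lmul f g).
Proof.
move=> fM gN m MNm /=; apply: fsbig1 => j _.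
have [Mj|jM] := ltP M j; first by rewrite fM ?mul0r.
by rewrite gN ?mulr0//; lia.
Qed.

Lemma lmul1l f : lmul (lone R) f = f.
Proof.
apply: laurent_ext => m /=; rewrite (@fsbigE _ _ _ _ _ [:: 0 : int])//=.
  by rewrite big_cons big_nil in_setT mul1r subr0 addr0.
by move=> j _; rewrite inE => /negPf->; rewrite mul0r.
Qed.

Lemma lmul1r f : lmul f (lone R) = f.
Proof.
apply: laurent_ext => m /=; rewrite (@fsbigE _ _ _ _ _ [:: m])//=.
  by rewrite big_cons big_nil in_setT subrr mulr1 addr0.
by move=> j _; rewrite inE => jm; rewrite subr_eq0 eq_sym (negPf jm) mulr0.
Qed.

Lemma lmul0l f : lmul 0 f = 0.
Proof. by apply: laurent_ext => m /=; apply: fsbig1 => j _; rewrite mul0r. Qed.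

Lemma lmul0r f : lmul f 0 = 0.
Proof. by apply: laurent_ext => m /=; apply: fsbig1 => j _; rewrite mulr0. Qed.

Lemma hhat_lone q a : hhat q a (lone R) = lone R.
Proof.
apply: laurent_ext => m /=; have [->|] := eqVneq m 0; last by rewrite mulr0.
by rewrite expr0z mulr1.
Qed.

Lemma hhat0 q a : hhat q a (0 : laurent R) = 0.
Proof. by apply: laurent_ext => m /=; rewrite mulr0. Qed.

Lemma hhat_id q f : hhat q 0 f = f.
Proof.
by apply: laurent_ext => m /=; rewrite /qpow mul0r cexp0 exp1rz mul1r.
Qed.

Lemma vanishes_above_hhat q a N f :
  vanishes_above N f -> vanishes_above N (hhat q a f).
Proof. by move=> fN m Nm /=; rewrite fN// mulr0. Qed.

Lemma qpowMz (q b t : R[i]) m :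
  qpow q (b * t) ^ m = cexp (b * cln q * m%:~R * t).
Proof. by rewrite /qpow cexpMz; congr cexp; ring. Qed.

Lemma lmultiplier_subproof (k : int -> R[i]) f :
  (fun m => k m * f m) \in @finite_top R.
Proof.
by have [N fN] := laurent_top f; apply/asboolP; exists N => m /fN->;
  rewrite mulr0.
Qed.

End LaurentAlgebra.

(** * The equation as a triangular system *)

Section Flow.
Variables (R : realType) (q : R[i]).
Implicit Types (X A : qsym R) (x y : nat -> laurent R) (e b : R[i]).

(** The coefficient of [D^(-n)] in [(\sum_i u_i D^(-i)) sigma_e(X)], where the
    last index [i = n] is left out because [x_0 = 0]. *)
Definition flow e x (u : nat -> laurent R) n : laurent R :=
  \sum_(i < n) lmul (u i) (hhat q (- (i : nat)%:R) (hhat q e (x (n - i)%N))).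

Lemma qcoef_mulDr X b n : qcoef (qmul q X (Dpow b)) n = qcoef X n.
Proof.
rewrite /= big_ord_recr /= subnn hhat_lone lmul1r big1 ?add0r// => i _.
by rewrite subn_eq0 leqNgt ltn_ord /= hhat0 lmul0r.
Qed.

Lemma qcoef_sigma b X n : qcoef (qsigma q b X) n = hhat q b (qcoef X n).
Proof.
rewrite /qsigma qcoef_mulDr /= big_ord_recl /= lmul1l subr0 subn0.
by rewrite big1 ?addr0// => i _; rewrite lmul0l.
Qed.

Lemma qcoef_mul_sigma e A X n : qord A = 0 -> qcoef X 0%N = 0 ->
  qcoef (qmul q A (qsigma q e X)) n = flow e (qcoef X) (qcoef A) n.
Proof.
move=> A0 X0; rewrite /qmul; cbn [qcoef].
under eq_bigr => i _ do rewrite qcoef_sigma A0 sub0r.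
by rewrite big_ord_recr /= subnn X0 !hhat0 lmul0r addr0.
Qed.

Lemma eq_flow e x y (u v : nat -> laurent R) n :
  (forall i, (i < n)%N -> u i = v i) ->
  (forall i, (0 < i <= n)%N -> x i = y i) ->
  flow e x u n = flow e y v n.
Proof.
move=> uv xy; apply: eq_bigr => i _; rewrite uv// xy//.
by rewrite subn_gt0 ltn_ord leq_subr.
Qed.

(** Isolates the only term that involves [x_(n+1)]. *)
Lemma flowS e x (u : nat -> laurent R) n : u 0%N = lone R ->
  flow e x u n.+1 = hhat q e (x n.+1) +
    \sum_(i < n) lmul (u i.+1)
       (hhat q (- (i.+1)%:R) (hhat q e (x (n - i)%N))).
Proof.
by move=> u0; rewrite /flow big_ord_recl /= u0 lmul1l oppr0 hhat_id subn0.
Qed.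

End Flow.

(** * Laurent series depending on a complex parameter *)

Section Regular.
Variables (R : realType) (q : R[i]).
Local Notation C := R[i].
Implicit Types f g : C -> laurent R.

(** The bound on the degrees must be uniform in [t]: otherwise the primitives
    of the coefficients need not form a Laurent series, and the coefficients of
    a product need not be exponential polynomials. *)
Definition regular f :=
  (exists N, forall t, vanishes_above N (f t)) /\
  forall m, exppoly (fun t => f t m).

Lemma regular_cst (f : laurent R) : regular (fun=> f).
Proof.
split; first by have [N fN] := laurent_top f; exists N.
by move=> m; exact: exppoly_cst.
Qed.

Lemma regularD f g : regular f -> regular g -> regular (fun t => f t + g t).
Proof.
move=> [[M fM] fE] [[N gN] gE].
split; last by move=> m; exact: (exppolyD (fE m) (gE m)).
exists (Num.max M N) => t m; rewrite gt_max => /andP[Mm Nm].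
by rewrite lcoefD fM// gN// addr0.
Qed.

Lemma regular_sum n (f : nat -> C -> laurent R) :
  (forall i, (i < n)%N -> regular (f i)) ->
  regular (fun t => \sum_(i < n) f i t).
Proof.
elim: n => [|n IH] fP.
  have := regular_cst 0; congr regular.
  by apply/funext => t; rewrite big_ord0.
have := regularD (IH (fun i ni => fP i (ltnW ni))) (fP n (ltnSn n)).
by congr regular; apply/funext => t; rewrite big_ord_recr /=.
Qed.

Lemma regular_lmul_hhat f c b (g : laurent R) : regular f ->
  regular (fun t => lmul (f t) (hhat q c (hhat q (b * t) g))).
Proof.
move=> [[M fM] fE]; have [N gN] := laurent_top g.
have hN t : vanishes_above N (hhat q c (hhat q (b * t) g)).
  by do 2 apply: vanishes_above_hhat.
split; first by exists (M + N) => t; exact: vanishes_above_lmul.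
move=> m; have [r rE] := lmul_big R M N m.
have : exppoly (fun t =>
    \sum_(j <- r) f t j * hhat q c (hhat q (b * t) g) (m - j)).
  apply: exppoly_sum => j.
  have := exppolyM_cexp (qpow q c ^ (m - j) * g (m - j))
    (b * cln q * (m - j)%:~R) (fE j).
  by congr exppoly; apply/funext => t /=; rewrite qpowMz; ring.
by congr exppoly; apply/funext => t; rewrite rE.
Qed.

(** [insubd] makes this total; [lprimitiveE] gives its meaning on regular
    families. *)
Definition lprimitive f (t : C) : laurent R :=
  insubd 0 (fun m => primitive (fun s => f s m) t).

Lemma lprimitiveE f t m :
  regular f -> lprimitive f t m = primitive (fun s => f s m) t.
Proof.
move=> [[N fN] _]; rewrite -[LHS]/(val (lprimitive f t) m) val_insubd ifT//.
apply/asboolP; exists N => k Nk; have -> : (fun s => f s k) = fun=> 0.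
  by apply/funext => s; rewrite fN.
by rewrite primitive0.
Qed.

Lemma regular_lprimitive f : regular f -> regular (lprimitive f).
Proof.
move=> fR; have [[N fN] fE] := fR; split.
  exists N => t m Nm; rewrite lprimitiveE//.
  have -> : (fun s => f s m) = fun=> 0.
    by apply/funext => s; rewrite fN.
  by rewrite primitive0.
move=> m; have [+ _] := exppoly_primitive (fE m); congr exppoly.
by apply/funext => t; rewrite lprimitiveE.
Qed.

End Regular.

(** * Solving the system *)

(** Course-of-values recursion, which yields the [a_n] of a solution and the
    [x_n] of a preimage. *)
Lemma strong_rec (T : Type) (d : T) (F : nat -> (nat -> T) -> T) :
  exists a, forall n, a n = F n (fun i => if (i < n)%N then a i else d).
Proof.
pose fix s n := if n is n'.+1 then rcons (s n') (F n' (nth d (s n'))) else [::].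
have s_size n : size (s n) = n by elim: n => //= n IH; rewrite size_rcons IH.
have nth_s n i : nth d (s n) i = if (i < n)%N then F i (nth d (s i)) else d.
  elim: n => [|n IH] /=; first by rewrite nth_nil.
  by rewrite nth_rcons s_size ltnS; case: ltngtP IH => // ->.
exists (fun n => F n (nth d (s n))) => n; congr F.
by apply/funext => i; rewrite nth_s.
Qed.

Section CoefficientFlow.
Variables (R : realType) (q b : R[i]).
Local Notation C := R[i].
Implicit Types (x y : nat -> laurent R) (a c : C -> nat -> laurent R).

Definition coef_solution x a :=
  [/\ forall t, a t 0%N = lone R,
      forall n, a 0 n.+1 = 0 &
      forall (t : C^o) n m, is_derive t (1 : C^o)
        (fun s : C^o => a s n m : C^o) (flow q (b * t) x (a t) n m)].

Lemma regular_flow x a n : (forall i, (i < n)%N -> regular (a^~ i)) ->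
  regular (fun t => flow q (b * t) x (a t) n).
Proof.
move=> aR; apply: (@regular_sum R n (fun i t =>
  lmul (a t i) (hhat q (- i%:R) (hhat q (b * t) (x (n - i)%N))))).
by move=> i /aR ai; exact: regular_lmul_hhat.
Qed.

Lemma coef_solution_exists x : exists a, coef_solution x a.
Proof.
have [a aE] := strong_rec (fun=> 0) (fun n (u : nat -> C -> laurent R) =>
  if n == 0%N then fun=> lone R else
  lprimitive (fun t => flow q (b * t) x (u^~ t) n)).
(* flow only looks at indices below n, so the truncation disappears *)
have {}aE n : a n = if n == 0%N then fun=> lone R else
    lprimitive (fun t => flow q (b * t) x (a^~ t) n).
  rewrite aE; case: eqP => // _; congr lprimitive; apply/funext => t.
  by apply: eq_flow => // i ->.
have aR n : regular (a n).
  elim/ltn_ind: n => n IH; rewrite aE; case: eqP => _; first exact: regular_cst.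
  by apply/regular_lprimitive/(@regular_flow x (fun t n => a n t)).
have fR n := @regular_flow x (fun t n => a n t) n (fun i _ => aR i).
exists (fun t n => a n t); split=> [t|n|t [|n] m]; first by rewrite aE.
- apply: laurent_ext => m; rewrite aE/= lprimitiveE//.
  by have [_ []] := exppoly_primitive ((fR n.+1).2 m).
- rewrite /flow big_ord0.
  under eq_fun do rewrite aE/=.
  exact: is_derive_cst.
under eq_fun do rewrite aE/= lprimitiveE//.
by have [_ [_]] := exppoly_primitive ((fR n.+1).2 m).
Qed.

(** Uniqueness (take [x = y]), in the stronger form that the components below
    [n] of a solution only depend on the data below [n]. *)
Lemma coef_solution_local x y a c n :
  coef_solution x a -> coef_solution y c ->
  (forall i, (0 < i < n)%N -> x i = y i) ->
  forall i, (i < n)%N -> forall t, a t i = c t i.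
Proof.
move=> [a0 a00 ad] [c0 c00 cd] xy; elim/ltn_ind => -[|i] IH ni t.
  by rewrite a0 c0.
apply: laurent_ext => m.
have := @derive_inj R (fun t => a t i.+1 m) (fun t => c t i.+1 m)
  (fun t => flow q (b * t) x (a t) i.+1 m).
move=> /(_ _ _ _)/(congr1 (@^~ t)); apply => // [|s]; first by rewrite a00 c00.
rewrite (@eq_flow _ _ _ _ y _ (c s))// => [j ji|j /andP[j0 ji]].
  by apply: IH => //; exact: ltn_trans ni.
by apply: xy; rewrite j0 (leq_ltn_trans ji).
Qed.

(** Changing [x_n] alone changes the derivative of the [m]-th coefficient of
    [a_n] by [(x_(n,m) - y_(n,m)) e^(w t)], where [w = b m ln q]; integrate
    from [0] to [1]. *)
Lemma coef_solution_variation x y a c n m :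
  coef_solution x a -> coef_solution y c -> (0 < n)%N ->
  (forall i, (0 < i < n)%N -> x i = y i) ->
  a 1 n m - c 1 n m =
    (x n m - y n m) * primitive (fun t => cexp (b * cln q * m%:~R * t)) 1.
Proof.
case: n => // n aP cP _ xy; have ac := coef_solution_local aP cP xy.
have [a0 a00 ad] := aP; have [c0 c00 cd] := cP.
set w := b * _ * _.
have [_ wP] : exppoly (primitive (fun t => cexp (w * t))) /\
    is_primitive (fun t => cexp (w * t)) (primitive (fun t => cexp (w * t))).
  apply: exppoly_primitive; have := exppoly_monomial 1 0 w.
  by congr exppoly; apply/funext => t; rewrite expr0 !mul1r.
suff E : is_primitive (fun t => (x n.+1 m - y n.+1 m) * cexp (w * t))
    (fun t => a t n.+1 m - c t n.+1 m).
  have := primitiveE E.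
  by rewrite (primitiveE (is_primitiveZ _ wP)) => /(congr1 (@^~ 1)).
split; first by rewrite a00 c00 subrr.
move=> t; apply: (is_derive_eq (is_deriveB (ad t n.+1 m) (cd t n.+1 m))).
rewrite !flowS//.
rewrite (eq_bigr (fun i : 'I_n => lmul (c t i.+1)
       (hhat q (- (i.+1)%:R) (hhat q (b * t) (y (n - i)%N))))).
  by rewrite !lcoefD /= qpowMz -/w; ring.
move=> i _; rewrite ac ?ltnS// xy// subn_gt0 ltn_ord/= ltnS.
exact: leq_subr.
Qed.

(** * Inverting the map from X to A(1) *)

(** No resonance between the flow and a power of [z]: each factor that
    multiplies [x_(n,m)] in [coef_solution_variation] is nonzero. *)
Definition nonresonant := forall m : int,
  primitive (fun t => cexp (b * cln q * m%:~R * t)) 1 != 0.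

Lemma coef_solution_inj x y a c : nonresonant ->
  coef_solution x a -> coef_solution y c ->
  x 0%N = y 0%N -> (forall n, a 1 n = c 1 n) -> x = y.
Proof.
move=> nonres aP cP xy0 ac; apply/funext; elim/ltn_ind => -[//|n] IH.
apply: laurent_ext => m.
have := coef_solution_variation m aP cP (ltn0Sn n).
move=> /(_ (fun i ni => IH i (proj2 (andP ni)))).
rewrite ac subrr => /esym/eqP; rewrite mulf_eq0 (negPf (nonres m)) orbF.
by rewrite subr_eq0 => /eqP.
Qed.

(** Built recursively: solve the system with [x_i] replaced by [0] for
    [i >= n], and take as [x_n] the resulting defect at [D^(-n)], divided
    coefficientwise by the factors of [coef_solution_variation]. *)
Lemma coef_solution_surj (l : nat -> laurent R) : nonresonant ->
  l 0%N = lone R ->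
  exists x, x 0%N = 0 /\ exists2 a, coef_solution x a & a 1 = l.
Proof.
move=> nonres l0; have [sol solP] := choice coef_solution_exists.
pose k m := primitive (fun t => cexp (b * cln q * m%:~R * t)) 1.
have [x xE] := strong_rec (0 : laurent R) (fun n y => if n == 0%N then 0 else
  Laurent (lmultiplier_subproof (fun m => (k m)^-1) (l n - sol y 1 n))).
have x0 : x 0%N = 0 by rewrite xE.
exists x; split => //; exists (sol x) => //; apply/funext => -[|n].
  by have [-> _ _] := solP x.
apply: laurent_ext => m; set y := fun i => if (i < n.+1)%N then x i else 0.
have := coef_solution_variation m (solP x) (solP y) (ltn0Sn n).
have -> : y n.+1 = 0 by rewrite /y ltnn.
rewrite -/(k m) [x n.+1]xE /= -/y => /(_ _)/(canRL (subrK _))->.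
  by rewrite subr0 mulrAC mulVf ?nonres// mul1r subrK.
by move=> i /andP[_ ni]; rewrite /y ni.
Qed.

(** A zero of [(e^w - 1) / w], [w = b m ln q], would be a nonzero
    [w = 2 pi i k], so that [b ln q / (2 pi i) = k / m]. *)
Lemma nonresonant_irrational :
  ~ (exists r : rat, b * cln q / (2 * pi%:C * 'i) = ratr r) -> nonresonant.
Proof.
move=> irr m; apply: primitive_cexp_neq0 => k.
have [->|m0] := eqVneq m 0; first by rewrite mulr0.
move=> wk; case: irr; exists (k%:~R / m%:~R).
have mC0 : m%:~R != 0 :> R[i] by rewrite intr_eq0.
have piC0 : 2 * pi%:C * 'i != 0 :> R[i].
  have i0 : 'i != 0 :> R[i] by rewrite -normr_eq0 normc_i oner_neq0.
  by rewrite !mulf_neq0// ?pnatr_eq0// eq_complex /= negb_and gt_eqF ?pi_gt0.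
rewrite [ratr _]fmorph_div !rmorph_int; apply: (mulIf piC0); rewrite divfK//.
apply: (mulIf mC0); rewrite wk !rmorphM rmorph_int rmorph_nat /=.
by field.
Qed.

End CoefficientFlow.

(** * The exponential map *)

Section Exponential.
Variables (R : realType) (q : R[i]).
Implicit Types (A : R[i] -> qsym R) (Y : qsym R * R[i]).

Lemma exp_solutionP Y A : Jhat Y -> exp_solution q Y A <->
  (forall t, qord (A t) = 0) /\
  coef_solution q Y.2 (qcoef Y.1) (fun t => qcoef (A t)).
Proof.
case: Y => X b [X0 Xc]; split=> /=.
  move=> [AG A0 Ad]; have Ao t : qord (A t) = 0 by have [] := AG t.
  split=> //; split=> [t|n|t n m]; first by have [] := AG t.
  - by rewrite A0.
  - by have := Ad t n m; rewrite qcoef_mul_sigma.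
move=> [Ao [A0 A00 Ad]]; split=> [t||t n m]; first by split.
  case: (A 0) (Ao 0) (A0 0) A00 => _ a /= -> a0 a00; congr QSym.
  by apply/funext => -[|n]; rewrite ?a0 ?a00.
by rewrite qcoef_mul_sigma.
Qed.

Lemma exp_solution_exists_unique Y :
  Jhat Y -> exists! A, exp_solution q Y A.
Proof.
move=> YJ; have [a aP] := coef_solution_exists q Y.2 (qcoef Y.1).
exists (fun t => QSym 0 (a t)); split; first exact/(exp_solutionP _ YJ).
move=> A /(exp_solutionP _ YJ)[A0 AP]; apply/funext => t.
case: (A t) (A0 t) (fun n =>
  @coef_solution_local _ _ _ _ _ _ _ n.+1 aP AP (fun _ _ => erefl)
    n (ltnSn n) t) => _ u /= -> au.
by congr QSym; apply/funext.
Qed.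

(** Right multiplication by [D^b] only shifts the order, so [exp Y] and [A(1)]
    have the same coefficients. *)
Lemma qexpE Y A : Jhat Y -> exp_solution q Y A ->
  qexp q Y = QSym Y.2 (qcoef (A 1)).
Proof.
move=> YJ AP; have [B [BP BU]] := exp_solution_exists_unique YJ.
rewrite /qexp /qexp_path; case: xgetP => [A' _ /= A'P|/(_ A)//].
rewrite -(BU _ A'P) (BU _ AP) mulr1.
have /(exp_solutionP _ YJ)[A0 _] := AP.
rewrite -[qmul _ _ _]/(QSym _ (qcoef (qmul q (A 1) (Dpow Y.2)))).
rewrite [X in QSym X _]/= A0 add0r; congr QSym; apply/funext => n.
exact: qcoef_mulDr.
Qed.

Lemma qexp_in_Ghat Y : Jhat Y -> Ghat Y.2 (qexp q Y).
Proof.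
move=> YJ; have [A [AP _]] := exp_solution_exists_unique YJ.
rewrite (qexpE YJ AP); have [AG _ _] := AP.
by split=> //; have [] := AG 1.
Qed.

End Exponential.

Theorem proposition3p5 (R : realType) (q : R[i])
    (hq : 0 < `|q| < 1) (harg : - pi < carg q < pi) :
  ((forall Y : qsym R * R[i], Jhat Y ->
      exists! A : R[i] -> qsym R, exp_solution q Y A) /\
   set_fun (@Jhat R) (@Ghatminus R) (qexp q)) /\
  (forall alpha : R[i],
     ~ (exists r : rat, alpha * cln q / (2 * pi%:C * 'i) = ratr r) ->
     set_bij (Jhat_aff alpha) (Ghat alpha) (qexp q)).
Proof.
split; first split.
- exact: exp_solution_exists_unique.
- by move=> Y YJ; exists Y.2 => //; exact: qexp_in_Ghat.
move=> alpha /nonresonant_irrational nonres.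
split.
- by move=> Y [YJ <-]; exact: qexp_in_Ghat.
- move=> [X b] [X' b']; rewrite !inE => - [/= XJ ->] [/= XJ' ->].
  have XJh : Jhat (X, alpha) by [].
  have XJh' : Jhat (X', alpha) by [].
  have [A [AP _]] := exp_solution_exists_unique q XJh.
  have [A' [AP' _]] := exp_solution_exists_unique q XJh'.
  rewrite (qexpE XJh AP) (qexpE XJh' AP') => - [AA'].
  have /(exp_solutionP _ _ XJh)[_ aP] := AP.
  have /(exp_solutionP _ _ XJh')[_ aP'] := AP'.
  case: X X' XJ XJ' XJh XJh' AP AP' aP aP' => [d x] [d' x'].
  move=> [/= -> x0] [/= -> x'0] _ _ _ _ aP aP'.
  rewrite (coef_solution_inj nonres aP aP')//; first by rewrite x0.
  by move=> n; rewrite AA'.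
- move=> [d l] [/= -> l0].
  have [x [x0 [a aP al]]] := coef_solution_surj nonres l0.
  have XJ : Jhat (QSym 0 x, alpha) by split.
  exists (QSym 0 x, alpha); first by split=> //; split.
  rewrite (@qexpE _ q _ (fun t => QSym 0 (a t)) XJ) /= ?al//.
  exact/(exp_solutionP _ _ XJ).
Qed.
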